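(* Let $A\in\mathbb{R}^{n\times n}$ and $B,C^{T}\in\mathbb{R}^{n\times m}$ be such that the system $(A,B,C)$ is minimum phase, i.e. all zeros of the polynomial $\lambda\mapsto\det\begin{bmatrix}A-\lambda I & B\\ C & 0\end{bmatrix}$ lie in the open left half-plane, and such that $(CB)^{T}+CB$ is positive definite. Let $\mathbb{T}$ be a time scale, unbounded above, with $0\in\mathbb{T}$, and let $k\in\mathcal{K}$, that is, $k:\mathbb{T}\to\mathbb{R}^{+}$ is rd-continuous, $k^{\Delta}(t)\ge0$ for all $t\in\mathbb{T}$, and $\lim_{t\to\infty}k(t)=\infty$. Then there exist a nonzero graininess bound $\bar\mu:\mathbb{T}\to(0,\infty)$, a time $t^{*}\in\mathbb{T}$ and a (small) constant $\varepsilon_2>0$ such that for all $t\in\mathbb{T}$ with $t>t^{*}$ and all graininess values $0\le\mu(t)\le\bar\mu(t)$, the matrix $-k(t)C\hat B(t)$, where $\hat B(t)=\operatorname{expc}(\mu(t)A)B$, satisfies a time scale Lyapunov equation with $P=I$ and $Q(t)\ge\varepsilon_2 I$; that is, $$(-k(t)C\hat B(t))^{T}+(-k(t)C\hat B(t))+\mu(t)\,(-k(t)C\hat B(t))^{T}(-k(t)C\hat B(t))=-Q(t)$$ with $Q(t)$ symmetric and $Q(t)\ge\varepsilon_2 I$.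
   Context: A time scale $\mathbb{T}$ is a nonempty closed subset of $\mathbb{R}$. For $t\in\mathbb{T}$ the forward jump is $\sigma(t)=\inf\{s\in\mathbb{T}:s>t\}$ and the graininess is $\sigma(t)-t\ge0$. The delta derivative $f^{\Delta}(t)$ is the (Hilger) derivative: the difference quotient $(f(\sigma(t))-f(t))/(\sigma(t)-t)$ if $\sigma(t)>t$, and the limit $\lim_{s\to t,\,s\in\mathbb{T}}(f(t)-f(s))/(t-s)$ if $\sigma(t)=t$. A function on $\mathbb{T}$ is rd-continuous if it is continuous at right-dense points ($\sigma(t)=t$) and has finite left-sided limits at left-dense points. $\mathbb{R}^+$ denotes the positive reals. For a square matrix $X$, $\operatorname{expc}(X):=\sum_{j=1}^{\infty}\frac{1}{j!}X^{j-1}=I+\frac12X+\frac16X^2+\cdots$. The generalized time scale Lyapunov equation for a matrix $M(t)$ is $M(t)^{T}P(t)+P(t)M(t)+\mu(t)M(t)^{T}P(t)M(t)=-Q(t)$ with $Q(t)$ positive definite. Matrix inequalities are in the sense of positive semidefiniteness. *)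

(* Defs.v *)
From HB Require Import structures.
From mathcomp Require Import all_boot all_order all_algebra.
From mathcomp Require Import complex.
From mathcomp Require Import all_classical all_reals all_analysis.

Set Implicit Arguments.
Unset Strict Implicit.
Unset Printing Implicit Defensive.

Import Order.TTheory GRing.Theory Num.Theory.
Import numFieldNormedType.Exports.

Local Open Scope classical_set_scope.
Local Open Scope ring_scope.

(* Functions on a time scale T are represented by functions R -> R whose values
   outside T are never used. *)
Section TimeScale.
Context {R : realType}.
Implicit Types (T : set R) (f k : R -> R) (t d : R).

Definition time_scale T := closed T /\ T !=set0.

Definition unbounded_above T := forall M : R, exists2 t, T t & M < t.

(* At a maximum of T this is the junk value inf set0 = 0; it is only used
   for time scales that are unbounded above. *)
Definition sigma T t : R := inf [set s | T s /\ t < s].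

Definition graininess T t : R := sigma T t - t.

Definition right_dense T t := sigma T t = t.

(* The nonemptiness clause excludes a minimum of T, where the supremum
   is the junk value 0. *)
Definition left_dense T t :=
  [set s | T s /\ s < t] !=set0 /\ sup [set s | T s /\ s < t] = t.

Definition has_delta_derivative T f t d : Prop :=
  if t < sigma T t then d = (f (sigma T t) - f t) / graininess T t
  else (f t - f s) / (t - s) @[s --> within T t^'] --> d.

Definition rd_continuous T f :=
  (forall t, T t -> right_dense T t -> f s @[s --> within T (nbhs t)] --> f t) /\
  (forall t, T t -> left_dense T t ->
     exists l : R, f s @[s --> within T t^'-] --> l).

Definition classK T k :=
  [/\ forall t, T t -> 0 < k t,
      rd_continuous T k,
      forall t, T t -> exists2 d, has_delta_derivative T k t d & 0 <= d
    & k t @[t --> within T +oo] --> +oo].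

End TimeScale.

Section Matrices.
Context {R : realType}.

Definition posdefmx n (M : 'M[R]_n) :=
  M^T = M /\ forall x : 'cV[R]_n, x != 0 -> 0 < (x^T *m M *m x) 0 0.

Definition possemidefmx n (M : 'M[R]_n) :=
  M^T = M /\ forall x : 'cV[R]_n, 0 <= (x^T *m M *m x) 0 0.

(* M >= N in the Loewner order *)
Definition loewner_ge n (M N : 'M[R]_n) := possemidefmx (M - N).

Definition expc n (X : 'M[R]_n) : 'M[R]_n :=
  limn (fun N : nat => \sum_(1 <= j < N) (j`!%:R)^-1 *: X ^+ j.-1).

Definition zero_poly n m (A : 'M[R]_n) (B : 'M[R]_(n, m)) (C : 'M[R]_(m, n)) :
    {poly R} :=
  \det (block_mx (map_mx polyC A - 'X%:M) (map_mx polyC B) (map_mx polyC C) 0).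

Definition minimum_phase n m (A : 'M[R]_n) (B : 'M[R]_(n, m))
    (C : 'M[R]_(m, n)) :=
  forall z : R[i],
    root (map_poly (real_complex R) (zero_poly A B C)) z -> complex.Re z < 0.

Definition ts_lyapunov n (mu : R) (M P Q : 'M[R]_n) :=
  posdefmx Q /\ M^T *m P + P *m M + mu *: (M^T *m P *m M) = - Q.

Definition Bhat n m (A : 'M[R]_n) (B : 'M[R]_(n, m)) (mu : R) : 'M[R]_(n, m) :=
  expc (mu *: A) *m B.

End Matrices.

(* Main.v *)
From HB Require Import structures.
Require Import Defs.
From mathcomp Require Import all_boot all_order all_algebra.
From mathcomp Require Import all_classical all_reals all_analysis.
From mathcomp Require Import ring lra.

Set Implicit Arguments.
Unset Strict Implicit.
Unset Printing Implicit Defensive.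

Import Order.TTheory GRing.Theory Num.Theory.
Import numFieldNormedType.Exports.

Local Open Scope classical_set_scope.
Local Open Scope ring_scope.

(** Write G for C *m Bhat A B mu. With P = I and M = - k G, the Lyapunov
    equation forces Q = k (G^T + G) - mu k^2 G^T G, so everything amounts to
    bounding this symmetric matrix from below, uniformly in t.

    At mu = 0 one has G = C B, and (C B)^T + C B, being positive definite, is
    at least d I for some d > 0 ([posdefmx_coercive]). Since expc is continuous
    at 0 with an explicit modulus ([expc_sub_id_le]), there is a threshold e,
    independent of t, such that G^T + G >= (d/2) I and |G| stays bounded as
    soon as mu <= e ([mul_Bhat_near0]). The linear term of Q is then at least
    k (d/2) I, whereas the quadratic one is at most mu k^2 g I for a constant g;
    requiring also mu <= d / (4 g k(t)) makes the latter at most k (d/4) I.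
    Hence Q >= k (d/4) I, and as k tends to infinity k >= 1 from some time on,
    so that eps2 = d/4 works. The bound on mu depends on t only through the
    factor 1 / k(t).

    Quadratic forms are controlled by the entrywise maximum norm, which is not
    submultiplicative; this is where the dimensions appearing as factors in
    the estimates come from. *)

(** * The maximum norm and matrix products *)

Section MaxNorm.
Context {R : realType}.

Lemma mx_entry_le_norm m n (M : 'M[R]_(m, n)) i j : `|M i j| <= `|M|.
Proof. by rewrite [leRHS]mx_normrE; apply: (le_bigmax _ _ (i, j)). Qed.

Lemma mx_norm_le m n (M : 'M[R]_(m, n)) (c : R) :
  0 <= c -> (forall i j, `|M i j| <= c) -> `|M| <= c.
Proof.
by move=> c0 Mc; rewrite [leLHS]mx_normrE; apply/bigmax_leP.
Qed.

(** Each entry of the product is a sum of n products of entries. *)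
Lemma mx_norm_mulmx m n p (M : 'M[R]_(m, n)) (N : 'M[R]_(n, p)) :
  `|M *m N| <= n%:R * `|M| * `|N|.
Proof.
apply: mx_norm_le => [|i j]; first by rewrite !mulr_ge0.
rewrite mxE (le_trans (ler_norm_sum _ _ _))//.
apply: (@le_trans _ _ (\sum_(k < n) `|M| * `|N|)).
  by apply: ler_sum => k _; rewrite normrM ler_pM ?mx_entry_le_norm.
by rewrite sumr_const card_ord -[leLHS]mulr_natl mulrA.
Qed.

Lemma mx_norm_trmx m n (M : 'M[R]_(m, n)) : `|M^T| <= `|M|.
Proof. by apply: mx_norm_le => // i j; rewrite mxE mx_entry_le_norm. Qed.

(** The product estimate by itself would yield only n^(i-1) |X|^i, and only
    for i > 0; the form below also covers i = 0, and makes powers of X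
    dominated by a geometric sequence. *)
Lemma mx_norm_expr n (X : 'M[R]_n) i : `|X ^+ i| <= (n%:R * `|X|) ^+ i.
Proof.
elim: i => [|i IH].
  by rewrite !expr0; apply: mx_norm_le => // j k; rewrite mxE; case: eqP;
    rewrite ?normr1 ?normr0.
rewrite !exprS (le_trans (mx_norm_mulmx _ _))//.
by rewrite ler_wpM2l// mulr_ge0.
Qed.

End MaxNorm.

(** * Continuity of expc at the origin *)

Section Expc.
Context {R : realType}.

Lemma geometric_tail_le (a : R) N : 0 <= a <= 2^-1 ->
  \sum_(0 <= i < N) a ^+ i.+1 <= 2 * a.
Proof.
move=> /andP[a0 a1].
(* The subtracted term is what makes the induction go through. *)
suff H : \sum_(0 <= i < N) a ^+ i.+1 <= 2 * a - 2 * a ^+ N.+1.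
  by apply: le_trans H _; rewrite gerBl mulr_ge0 ?exprn_ge0.
elim: N => [|N IH]; first by rewrite big_geq// expr1 subrr.
rewrite big_nat_recr//= (exprS a N.+1).
have := exprn_ge0 N.+1 a0; nra.
Qed.

(** Joins the completeness and the norm of matrices, so that absolutely
    convergent series of matrices converge. *)
HB.instance Definition _ (m n : nat) := Complete.on 'M[R]_(m, n).

(** The terms of expc X other than the identity are dominated by those of the
    geometric series of ratio a = n |X|, whose tail is at most 2 a. *)
Lemma expc_sub_id_le n (X : 'M[R]_n) :
  n%:R * `|X| <= 2^-1 -> `|expc X - 1%:M| <= 2 * (n%:R * `|X|).
Proof.
set a := n%:R * `|X| => a1.
have a0 : 0 <= a by rewrite mulr_ge0.
pose u i : 'M[R]_n := (i.+1)`!%:R^-1 *: X ^+ i.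
have ua i : `|u i| <= a ^+ i.
  rewrite normrZ ger0_norm ?invr_ge0// -[leRHS]mul1r.
  apply: ler_pM; rewrite ?invr_ge0//; last exact: mx_norm_expr.
  by rewrite invf_le1 ?ltr0n ?fact_gt0// ler1n fact_gt0.
have cu : cvgn (series u).
  apply: normed_cvg; apply: (@series_le_cvg _ _ (geometric 1 a)) => [i|i|i|].
  - exact: normr_ge0.
  - by rewrite /= mul1r exprn_ge0.
  - by rewrite /= mul1r.
  - by apply: is_cvg_geometric_series; rewrite ger0_norm//
       (le_lt_trans a1)// invf_lt1// ltr1n.
have -> : expc X = limn (series u).
  apply: cvg_lim => //.
  (* The sum over 1 <= j < N has N - 1 terms, hence the shift. *)
  rewrite -cvg_shiftS; apply: cvg_trans cu; apply: near_eq_cvg; near=> N.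
  by rewrite /= big_add1.
have cd : (fun N => series u N.+1 - 1%:M) @ \oo --> limn (series u) - 1%:M.
  by apply: cvgB; [rewrite cvg_shiftS|exact: cvg_cst].
apply: (cvgr_to_le (cvg_norm cd)); near=> N.
rewrite /series/= big_nat_recl//= {1}/u expr0 invr1 scale1r addrC addKr.
apply: le_trans (ler_norm_sum _ _ _) _.
by apply: le_trans (geometric_tail_le N _); [exact: ler_sum|rewrite a0].
Unshelve. all: by end_near. Qed.

(** The difference is C (expc (mu A) - I) B, whose norm is at most a constant
    times mu for small mu. *)
Lemma mul_Bhat_near0 n m (A : 'M[R]_n) (B : 'M[R]_(n, m)) (C : 'M[R]_(m, n))
    (eta : R) : 0 < eta ->
  exists2 e : R, 0 < e &
    forall mu, 0 <= mu <= e -> `|C *m Bhat A B mu - C *m B| <= eta.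
Proof.
move=> eta0.
pose a := n%:R * `|A|.
pose K := n%:R * `|C| * (n%:R * 2 * `|B|).
have a0 : 0 <= a by rewrite mulr_ge0.
have K0 : 0 <= K by rewrite !mulr_ge0.
(* mu <= 1 / S ensures both 2 mu a <= 1, the range where expc is controlled,
   and mu K a <= eta, without dividing by a or K, which may vanish. *)
pose S := 1 + 2 * a + K * a / eta.
have Ka0 : 0 <= K * a / eta by rewrite divr_ge0 ?mulr_ge0// ltW.
have S0 : 0 < S by rewrite /S; lra.
exists S^-1; first by rewrite invr_gt0.
move=> mu /andP[mu0 muS].
have muS1 : mu * S <= 1 by rewrite -ler_pdivlMr// mul1r.
have muA : n%:R * `|mu *: A| = mu * a.
  by rewrite normrZ ger0_norm// mulrCA.
have mua : mu * a <= 2^-1 by move: muS1; rewrite /S; nra.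
have hE : `|expc (mu *: A) - 1%:M| <= 2 * (mu * a).
  by rewrite -muA expc_sub_id_le// muA.
rewrite /Bhat -mulmxBr -[X in _ - X]mul1mx -mulmxBl.
apply: le_trans (mx_norm_mulmx _ _) _.
apply: (@le_trans _ _ (n%:R * `|C| * (n%:R * (2 * (mu * a)) * `|B|))).
  rewrite ler_wpM2l ?mulr_ge0// (le_trans (mx_norm_mulmx _ _))//.
  by rewrite ler_wpM2r// ler_wpM2l.
have -> : n%:R * `|C| * (n%:R * (2 * (mu * a)) * `|B|) =
          mu * (K * a / eta) * eta.
  by rewrite /K; field; exact: lt0r_neq0.
rewrite ler_piMl// ?ltW//; move: muS1; rewrite /S; nra.
Qed.

End Expc.

(** * Quadratic forms *)

Section QuadraticForms.
Context {R : realType} {n : nat}.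
Implicit Types (M N H : 'M[R]_n) (x : 'cV[R]_n).

Definition qform M x : R := (x^T *m M *m x) 0 0.

Lemma qformD M N x : qform (M + N) x = qform M x + qform N x.
Proof. by rewrite /qform mulmxDr mulmxDl mxE. Qed.

Lemma qformZ c M x : qform (c *: M) x = c * qform M x.
Proof. by rewrite /qform -scalemxAr -scalemxAl mxE. Qed.

Lemma qformN M x : qform (- M) x = - qform M x.
Proof. by rewrite -scaleN1r qformZ mulN1r. Qed.

Lemma qform_id x : qform 1%:M x = \sum_i x i 0 ^+ 2.
Proof.
by rewrite /qform mulmx1 mxE; apply: eq_bigr => i _; rewrite mxE expr2.
Qed.

Lemma qform_id_ge0 x : 0 <= qform 1%:M x.
Proof. by rewrite qform_id sumr_ge0// => i _; rewrite sqr_ge0. Qed.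

Lemma qform_id_gt0 x : x != 0 -> 0 < qform 1%:M x.
Proof.
move=> x0; rewrite lt_neqAle qform_id_ge0 andbT eq_sym qform_id.
apply: contra x0 => /eqP/psumr_eq0P => H; apply/eqP/colP => i.
by rewrite mxE; apply/eqP; rewrite -sqrf_eq0; apply/eqP/H => // j _;
  rewrite sqr_ge0.
Qed.

(** Every product x_i x_j is at most (x_i^2 + x_j^2) / 2 in absolute value, and
    the sum of these means over all i and j is n times the square norm. *)
Lemma qform_norm_le N x : `|qform N x| <= n%:R * `|N| * qform 1%:M x.
Proof.
have qE : qform N x = \sum_j \sum_i x i 0 * N i j * x j 0.
  rewrite /qform mxE; apply: eq_bigr => j _; rewrite mxE mulr_suml.
  by apply: eq_bigr => i _; rewrite mxE.
pose s := qform 1%:M x.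
have bound : \sum_(j < n) \sum_(i < n) `|N| * ((x i 0 ^+ 2 + x j 0 ^+ 2) / 2) =
    n%:R * `|N| * s.
  transitivity (\sum_(j < n) `|N| * ((s + n%:R * x j 0 ^+ 2) / 2)).
    apply: eq_bigr => j _.
    rewrite -mulr_sumr -mulr_suml big_split/= -qform_id -/s.
    by rewrite sumr_const card_ord -[_ *+ n]mulr_natl.
  rewrite -mulr_sumr -mulr_suml big_split/= -mulr_sumr -qform_id -/s.
  by rewrite sumr_const card_ord -[_ *+ n]mulr_natl; field.
rewrite -/s -bound qE (le_trans (ler_norm_sum _ _ _))//; apply: ler_sum => j _.
rewrite (le_trans (ler_norm_sum _ _ _))//; apply: ler_sum => i _.
rewrite !normrM -(real_normK (num_real (x i 0))) -(real_normK (num_real (x j 0))).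
rewrite mulrAC mulrC ler_pM ?mulr_ge0 ?mx_entry_le_norm//.
have := sqr_ge0 (`|x i 0| - `|x j 0|); nra.
Qed.

Lemma posdefmx_unit H : posdefmx H -> H \in unitmx.
Proof.
move=> [_ Hpos]; rewrite -row_free_unit -kermx_eq0; apply/rowV0P => v.
move=> /sub_kermxP vH; apply/eqP; apply: contraT => v0.
have /Hpos : v^T != 0 by rewrite trmx_eq0.
by rewrite trmxK vH mul0mx mxE ltxx.
Qed.

(** An algebraic substitute for minimizing the form on the unit sphere, valid
    in every dimension including 0. For every real s, positivity at
    y = x - s H^-1 x reads
      0 <= x^T H x - 2 s |x|^2 + s^2 x^T H^-1 x,
    and s is chosen so small that the last term is at most s |x|^2, which
    leaves x^T H x >= s |x|^2. *)
Lemma posdefmx_coercive H : posdefmx H ->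
  exists2 d : R, 0 < d & forall x, d * qform 1%:M x <= qform H x.
Proof.
move=> Hpd; have Hu := posdefmx_unit Hpd; have [Hsym Hpos] := Hpd.
(* Adding 1 keeps c positive when n = 0. *)
pose c : R := n%:R * `|invmx H| + 1.
have c0 : 0 < c by rewrite ltr_wpDl// mulr_ge0.
exists c^-1; first by rewrite invr_gt0.
move=> x; set s := c^-1; have s0 : 0 < s by rewrite invr_gt0.
pose y := x - s *: (invmx H *m x).
have Hy : 0 <= qform H y.
  have [->|y0] := eqVneq y 0; first by rewrite /qform mulmx0 mxE.
  exact/ltW/Hpos.
have expand : qform H y =
    qform H x - 2 * s * qform 1%:M x + s ^+ 2 * qform (invmx H) x.
  have invT : (invmx H)^T = invmx H by rewrite trmx_inv Hsym.
  have yH : y^T *m H = x^T *m H - s *: x^T.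
    rewrite /y linearB linearZ/= trmx_mul invT mulmxBl -scalemxAl.
    by rewrite -mulmxA mulVmx// mulmx1.
  rewrite /qform yH /y mulmxBr !mulmxBl -!scalemxAr -!scalemxAl mulmx1.
  rewrite -(mulmxA x^T H (invmx H *m x)) (mulmxA H) mulmxV// mul1mx mulmxA.
  by rewrite !mxE; ring.
have inv_le : s * qform (invmx H) x <= qform 1%:M x.
  rewrite /s mulrC ler_pdivrMr// mulrC.
  apply: le_trans (ler_norm _) _; apply: le_trans (qform_norm_le _ _) _.
  by rewrite ler_wpM2r ?qform_id_ge0// /c lerDl.
move: Hy; rewrite expand; nra.
Qed.

End QuadraticForms.

(** * The Lyapunov equation *)

(** For P = I the equation determines Q, so that both its positivity and its
    lower bound are the single inequality on quadratic forms assumed here. *)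
Lemma ts_lyapunov_id_coercive (R : realType) m (G : 'M[R]_m) (k mu eps : R) :
  0 < eps ->
  (forall x, eps * qform 1%:M x <=
     k * qform (G^T + G) x - mu * k ^+ 2 * qform (G^T *m G) x) ->
  exists Q : 'M[R]_m,
    ts_lyapunov mu (- k *: G) 1%:M Q /\ loewner_ge Q (eps *: 1%:M).
Proof.
move=> eps0 hG.
pose Q := k *: (G^T + G) - (mu * k ^+ 2) *: (G^T *m G).
have qQ x : qform Q x =
    k * qform (G^T + G) x - mu * k ^+ 2 * qform (G^T *m G) x.
  by rewrite /Q [LHS]qformD qformN !qformZ.
have Qsym : Q^T = Q.
  by rewrite /Q linearB !linearZ/= linearD/= trmx_mul !trmxK addrC [G + _]addrC
    addrC.
exists Q; split; first split.
- split=> // x x0; change (0 < qform Q x).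
  by rewrite qQ (lt_le_trans _ (hG x))// mulr_gt0// qform_id_gt0.
- rewrite linearZ/= mulmx1 mul1mx -scalemxAl -scalemxAr !scalerA /Q.
  by move: (G^T *m G) => GG; apply/matrixP => i j; rewrite !mxE; ring.
- split; first by rewrite linearB linearZ/= trmx1 Qsym.
  move=> x; change (0 <= qform (Q - eps *: 1%:M) x).
  by rewrite qformD qformN qformZ subr_ge0 qQ.
Qed.

Lemma classK_eventually_ge (R : realType) (T : set R) (k : R -> R) (c : R) :
  unbounded_above T -> classK T k ->
  exists2 t0, T t0 & forall t, T t -> t0 < t -> c <= k t.
Proof.
move=> hT [_ _ _ /cvgryPge/(_ c)[M [_ hM]]].
have [t0 Tt0 Mt0] := hT M.
by exists t0 => // t Tt t0t; apply: hM => //; apply: lt_trans t0t.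
Qed.

Theorem lemma4p4 (R : realType) (n m : nat)
    (A : 'M[R]_n) (B : 'M[R]_(n, m)) (C : 'M[R]_(m, n))
    (hphase : minimum_phase A B C)
    (hCB : posdefmx ((C *m B)^T + C *m B))
    (T : set R) (hT : time_scale T) (hTunb : unbounded_above T) (hT0 : T 0)
    (k : R -> R) (hk : classK T k) :
  exists (mubar : R -> R) (tstar eps2 : R),
    [/\ forall t, T t -> 0 < mubar t,
        T tstar,
        0 < eps2
      & forall t, T t -> tstar < t ->
        forall mu : R, 0 <= mu <= mubar t ->
        exists Q : 'M[R]_m,
          ts_lyapunov mu (- k t *: (C *m Bhat A B mu)) 1%:M Q /\
          loewner_ge Q (eps2 *: 1%:M)].
Proof.
have [d d0 hd] := posdefmx_coercive hCB.
(* The perturbation of G^T + G has norm at most 2 eta, hence quadratic form at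
   most (d/2) |x|^2; adding 1 to m makes the division legitimate for m = 0. *)
pose eta := d / (4 * (m%:R + 1)).
have m1 : 0 < m%:R + 1 :> R by rewrite ltr_wpDl.
have eta0 : 0 < eta by rewrite divr_gt0// mulr_gt0.
have meta : m%:R * eta <= d / 4.
  have -> : m%:R * eta = d / 4 * (m%:R / (m%:R + 1)).
    by rewrite /eta; field; exact: lt0r_neq0.
  rewrite ler_piMr ?divr_ge0 ?(ltW d0)//.
  by rewrite ler_pdivrMr// mul1r lerDl.
have [e e0 he] := mul_Bhat_near0 A B C eta0.
(* Bounds the quadratic form of G^T G; one factor m comes from the product and
   one from the form, and the final 1 makes g positive. *)
pose g := m%:R * (m%:R * (`|C *m B| + eta) ^+ 2) + 1.
have g0 : 0 < g by rewrite ltr_wpDl// mulr_ge0// mulr_ge0// sqr_ge0.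
have [tstar Ttstar htstar] := classK_eventually_ge 1 hTunb hk.
have kpos t : T t -> 0 < k t by case: hk => + _ _ _; apply.
exists (fun t => Num.min e (d / (4 * g * k t))), tstar, (d / 4); split=> //.
- move=> t /kpos kt; rewrite lt_min e0 divr_gt0// !mulr_gt0//.
- by rewrite divr_gt0.
move=> t Tt tt mu; rewrite le_min => /and3P[mu0 mue mug].
have k1 := htstar t Tt tt; have k0 := kpos t Tt.
apply: ts_lyapunov_id_coercive; first by rewrite divr_gt0.
move=> x; set G := C *m Bhat A B mu; set q := qform 1%:M x.
have q0 : 0 <= q := qform_id_ge0 x.
have hD : `|G - C *m B| <= eta by apply: he; rewrite mu0.
have GCB : `|G| <= `|C *m B| + eta.
  by rewrite -[G](subrK (C *m B)) (le_trans (ler_normD _ _))// addrC lerD2l.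
have lin : d / 2 * q <= qform (G^T + G) x.
  set D := G - C *m B.
  have -> : G^T + G = ((C *m B)^T + C *m B) + (D^T + D).
    by rewrite /D linearB/= addrACA !subrKC.
  have DD : `|D^T + D| <= eta *+ 2.
    rewrite (le_trans (ler_normD _ _))// mulr2n lerD//.
    exact: le_trans (mx_norm_trmx _) hD.
  have : `|qform (D^T + D) x| <= d / 2 * q.
    apply: le_trans (qform_norm_le _ _) _; rewrite ler_wpM2r//.
    apply: (@le_trans _ _ (m%:R * (eta *+ 2))); first by rewrite ler_wpM2l.
    by rewrite mulrnAr mulr2n; lra.
  rewrite ler_norml => /andP[lb _]; rewrite qformD.
  have := hd x; rewrite -/q; lra.
have quad : qform (G^T *m G) x <= g * q.
  apply: le_trans (ler_norm _) _; apply: le_trans (qform_norm_le _ _) _.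
  rewrite ler_wpM2r// /g ler_wpDr// ler_wpM2l//.
  apply: le_trans (mx_norm_mulmx _ _) _.
  rewrite -mulrA ler_wpM2l// expr2 ler_pM//.
  exact: le_trans (mx_norm_trmx _) GCB.
have mugk : mu * k t * g <= d / 4.
  move: mug; rewrite ler_pdivlMr ?mulr_gt0//; lra.
have quad' : mu * k t ^+ 2 * qform (G^T *m G) x <= k t * (d / 4 * q).
  apply: (@le_trans _ _ (mu * k t ^+ 2 * (g * q))).
    by rewrite ler_wpM2l// mulr_ge0// sqr_ge0.
  have -> : mu * k t ^+ 2 * (g * q) = k t * (mu * k t * g * q) by ring.
  by rewrite ler_wpM2l ?(ltW k0)// ler_wpM2r.
have : k t * (d / 2 * q) <= k t * qform (G^T + G) x by rewrite ler_wpM2l// ltW.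
have : 1 * (d / 4 * q) <= k t * (d / 4 * q).
  by rewrite ler_wpM2r// mulr_ge0// divr_ge0// ltW.
lra.
Qed.
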